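(* Let $G$ be a finite $2$-group with $d(G)=3$, $\Phi(G)\le Z(G)$, $G'\cong C_2^3$ and $G/G'$ of type $(2^{m_1},2,2)$ with $m_1>1$, and suppose $G$ is determined by one of the characteristic matrices (M1)–(M7), (N1)–(N13), (O1)–(O3) listed in the context. (1) If $I_{\min}=1$, then the characteristic matrix is one of: (M2)–(M7), (N5)–(N6), (N10), (N12)–(N13). (2) If $I_{\min}=2$, then the characteristic matrix is one of: (M1), (N1)–(N4), (N7)–(N9), (N11), (O1)–(O3). (3) If $I_{\max}=m_1+2$, then the characteristic matrix is one of: (N11)–(N13), (O1)–(O3). (4) If $I_{\max}=m_1+1$, then the characteristic matrix is one of: (M4)–(M7), (N1) with $m_1=2$, (N2) with $m_1=2$, (N4)–(N10). (5) If $I_{\max}=m_1$, then the characteristic matrix is one of: (N1) with $m_1>2$, (N2) with $m_1>2$, (N3), (M1)–(M3).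
   Context: $d(G)$ is the minimal number of generators, $\Phi(G)$ the Frattini subgroup, $G'$ the derived subgroup, $C_2^3$ elementary abelian of order $8$, $F_2$ the field with $2$ elements. An $\mathcal{A}_1$-group is a minimal non-abelian group (non-abelian with all proper subgroups abelian). $2^{I_{\min}}$ and $2^{I_{\max}}$ denote respectively the minimal and the maximal index in $G$ of $\mathcal{A}_1$-subgroups of $G$. Characteristic matrix: let $G/G'$ have type $(2^{m_1},2^{m_2},2^{m_3})$, $m_1\ge m_2\ge m_3\ge1$ (i.e. $G/G'\cong C_{2^{m_1}}\times C_{2^{m_2}}\times C_{2^{m_3}}$). Choose $a_1,a_2,a_3\in G$ with $G/G'=\langle a_1G'\rangle\times\langle a_2G'\rangle\times\langle a_3G'\rangle$, $o(a_iG')=2^{m_i}$; put $x=[a_2,a_3]$, $y=[a_3,a_1]$, $z=[a_1,a_2]$, so $G'=\langle x,y,z\rangle$, and write $a_i^{2^{m_i}}=x^{w_{i1}}y^{w_{i2}}z^{w_{i3}}$. The matrix $w(G)=(w_{ij})$ over $F_2$ is called a characteristic matrix of $G$; together with $m_1,m_2,m_3$ it determines $G$ up to isomorphism. Let $e_{ij}$ be the $3\times3$ matrix over $F_2$ with $1$ at $(i,j)$ and $0$ elsewhere. The list is: (M1) $e_{11}+e_{23}+e_{32}$; (M2) $e_{11}+e_{22}+e_{33}$; (M3) $e_{11}+e_{22}+e_{32}+e_{33}$; (M4) $e_{13}+e_{22}+e_{31}$; (M5) $e_{13}+e_{21}+e_{32}$; (M6) $e_{13}+e_{22}+e_{31}+e_{32}$;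 (M7) $e_{12}+e_{13}+e_{22}+e_{31}+e_{32}$; (N1) $e_{23}+e_{32}$; (N2) $e_{22}+e_{33}$; (N3) $e_{22}+e_{32}+e_{33}$; (N4) $e_{22}+e_{23}+e_{31}+e_{32}+e_{33}$; (N5) $e_{11}+e_{23}$; (N6) $e_{11}+e_{33}$; (N7) $e_{23}+e_{31}$; (N8) $e_{21}+e_{33}$; (N9) $e_{21}+e_{23}+e_{33}$; (N10) $e_{13}+e_{32}$; (N11) $e_{13}+e_{21}$; (N12) $e_{13}+e_{31}$; (N13) $e_{13}+e_{21}+e_{31}$; (O1) $e_{11}$; (O2) $e_{21}$; (O3) $e_{21}+e_{31}$. *)

(* Defs.v *)
From mathcomp Require Import all_boot all_order all_algebra.
From mathcomp Require Import all_fingroup all_solvable.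

Set Implicit Arguments.
Unset Strict Implicit.
Unset Printing Implicit Defensive.

Local Open Scope group_scope.

Section A1.

Variable gT : finGroupType.
Implicit Types G H : {group gT}.

Definition A1_group G : bool :=
  ~~ abelian G && [forall H : {group gT}, (H \proper G) ==> abelian H].

Definition A1_subgroup H G : bool := (H \subset G) && A1_group H.

(* [has_Imin G k] and [has_Imax G k] say that I_min = k and I_max = k: the    *)
(* minimal, resp. maximal, index in G of an A_1-subgroup of G is 2 ^ k.       *)
Definition has_Imin G (k : nat) : Prop :=
  (exists2 H : {group gT}, A1_subgroup H G & #|G : H| = (2 ^ k)%N) /\
  (forall H : {group gT}, A1_subgroup H G -> (2 ^ k <= #|G : H|)%N).

Definition has_Imax G (k : nat) : Prop :=
  (exists2 H : {group gT}, A1_subgroup H G & #|G : H| = (2 ^ k)%N) /\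
  (forall H : {group gT}, A1_subgroup H G -> (#|G : H| <= 2 ^ k)%N).

End A1.

(* One-based row and column indices: [ix 1], [ix 2], [ix 3] enumerate 'I_3.   *)
Definition ix (i : nat) : 'I_3 := inord i.-1.

Section CharacteristicMatrix.

Variable gT : finGroupType.

(* The entries of w lie in 'F_2 and are coerced to the exponents 0 and 1.     *)
Definition row_word (w : 'M['F_2]_3) (x y z : gT) (i : nat) : gT :=
  x ^+ w (ix i) (ix 1) * y ^+ w (ix i) (ix 2) * z ^+ w (ix i) (ix 3).

(* A characteristic matrix depends on the choice of a1, a2, a3; this says     *)
(* that w arises from some such choice.                                       *)
Definition characteristic_matrix (G : {group gT}) (m1 m2 m3 : nat)
    (w : 'M['F_2]_3) : Prop :=
  exists a1 a2 a3 : gT,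
    let x := [~ a2, a3] in
    let y := [~ a3, a1] in
    let z := [~ a1, a2] in
    [/\ [/\ a1 \in G, a2 \in G & a3 \in G],
        <[coset G^`(1) a1]> \x <[coset G^`(1) a2]> \x <[coset G^`(1) a3]>
          = G / G^`(1),
        [/\ #[coset G^`(1) a1] = (2 ^ m1)%N,
            #[coset G^`(1) a2] = (2 ^ m2)%N
          & #[coset G^`(1) a3] = (2 ^ m3)%N]
      & [/\ a1 ^+ (2 ^ m1) = row_word w x y z 1,
            a2 ^+ (2 ^ m2) = row_word w x y z 2
          & a3 ^+ (2 ^ m3) = row_word w x y z 3]].

End CharacteristicMatrix.

Local Open Scope ring_scope.

Definition e (i j : nat) : 'M['F_2]_3 := delta_mx (ix i) (ix j).

Definition M1 : 'M['F_2]_3 := e 1 1 + e 2 3 + e 3 2.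
Definition M2 : 'M['F_2]_3 := e 1 1 + e 2 2 + e 3 3.
Definition M3 : 'M['F_2]_3 := e 1 1 + e 2 2 + e 3 2 + e 3 3.
Definition M4 : 'M['F_2]_3 := e 1 3 + e 2 2 + e 3 1.
Definition M5 : 'M['F_2]_3 := e 1 3 + e 2 1 + e 3 2.
Definition M6 : 'M['F_2]_3 := e 1 3 + e 2 2 + e 3 1 + e 3 2.
Definition M7 : 'M['F_2]_3 := e 1 2 + e 1 3 + e 2 2 + e 3 1 + e 3 2.

Definition N1 : 'M['F_2]_3 := e 2 3 + e 3 2.
Definition N2 : 'M['F_2]_3 := e 2 2 + e 3 3.
Definition N3 : 'M['F_2]_3 := e 2 2 + e 3 2 + e 3 3.
Definition N4 : 'M['F_2]_3 := e 2 2 + e 2 3 + e 3 1 + e 3 2 + e 3 3.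
Definition N5 : 'M['F_2]_3 := e 1 1 + e 2 3.
Definition N6 : 'M['F_2]_3 := e 1 1 + e 3 3.
Definition N7 : 'M['F_2]_3 := e 2 3 + e 3 1.
Definition N8 : 'M['F_2]_3 := e 2 1 + e 3 3.
Definition N9 : 'M['F_2]_3 := e 2 1 + e 2 3 + e 3 3.
Definition N10 : 'M['F_2]_3 := e 1 3 + e 3 2.
Definition N11 : 'M['F_2]_3 := e 1 3 + e 2 1.
Definition N12 : 'M['F_2]_3 := e 1 3 + e 3 1.
Definition N13 : 'M['F_2]_3 := e 1 3 + e 2 1 + e 3 1.

Definition O1 : 'M['F_2]_3 := e 1 1.
Definition O2 : 'M['F_2]_3 := e 2 1.
Definition O3 : 'M['F_2]_3 := e 2 1 + e 3 1.

Definition listed_matrices : seq 'M['F_2]_3 :=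
  [:: M1; M2; M3; M4; M5; M6; M7;
      N1; N2; N3; N4; N5; N6; N7; N8; N9; N10; N11; N12; N13;
      O1; O2; O3].

(* Main.v *)
(* Since Phi(G) is central, a subgroup of G is an A_1-subgroup iff it is <u, v>
   with [u, v] != 1; then <u, v> / phi2 u v is a four-group for the central
   subgroup phi2 u v = <u^2, v^2, [u, v]>, so |G : <u, v>| |phi2 u v| = 2^(m1 + 3)
   and I_min, I_max are governed by the extreme orders of phi2 u v.
   The map F_2^3 -> G', (p, q, r) |-> x^p y^q z^r is an isomorphism under which
   commutators become cross products and squares a quadratic map plus a power
   of a1.
   - |phi2 u v| is at most 2^(m1 + 2).  Up to replacing v by some v u^n, equality
     requires that v^2 is in G', a1 occurs in u with odd exponent, and
     a1^(2^m1), v^2, [u, v] span G'.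
   - |phi2 u v| <= 4 forces either u^2, v^2 in G', so the exponents of a1 are
     multiples of 2^(m1 - 1); or, after replacing v by v u or swapping, only
     v^2 in G' and the exponent of a1 in u is an odd multiple of 2^(m1 - 2),
     with a1^(2^m1), v^2 in <[u, v]>.  This exponent is odd exactly when m1 = 2,
     which is where (N1) and (N2) split.
   So everything depends on ranks of triples of vectors of F_2^3, which are
   enumerated for each of the 23 matrices. *)
Require Import Defs.
From mathcomp Require Import all_boot all_order all_algebra.
From mathcomp Require Import all_fingroup all_solvable.

Set Implicit Arguments.
Unset Strict Implicit.
Unset Printing Implicit Defensive.

Local Open Scope group_scope.

(** * Order bounds for p-groups and the Frattini subgroup of a 2-group *)

Definition phi2 {gT : finGroupType} (u v : gT) : {group gT} :=
  <<[set u ^+ 2; v ^+ 2; [~ u, v]]>>%G.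

Lemma card_pgroup_le (gT : finGroupType) (p k : nat) (H : {group gT}) :
  prime p -> p.-group H -> (#|H| < p ^ k.+1)%N -> (#|H| <= p ^ k)%N.
Proof.
move=> p_pr pH; rewrite (card_pgroup pH).
by rewrite ltn_exp2l ?prime_gt1 // ltnS => le; rewrite leq_exp2l ?prime_gt1.
Qed.

(** Modulo [B] the cyclic group generated by [g] has order dividing [n]. *)
Lemma card_cycle_mulG_le (gT : finGroupType) (g : gT) (B : {group gT}) n :
  g \in 'N(B) -> (0 < n)%N -> g ^+ n \in B -> (#|<[g]> <*> B| <= n * #|B|)%N.
Proof.
move=> nBg n0 gnB.
have nBcg : <[g]> <*> B \subset 'N(B) by rewrite join_subG normG cycle_subG nBg.
rewrite -(Lagrange (joing_subr <[g]> B)) mulnC leq_pmul2r ?cardG_gt0 //.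
rewrite -card_quotient // quotientYidr ?cycle_subG // quotient_cycle //.
by rewrite dvdn_leq // -orderE order_dvdn -morphX //= coset_id.
Qed.

Section FrattiniTwoGroup.

Variables (gT : finGroupType) (G : {group gT}).
Hypothesis G2 : 2.-group G.

Lemma sqr_in_Phi u : u \in G -> u ^+ 2 \in 'Phi(G).
Proof.
move=> Gu; rewrite (Phi_joing G2) mem_gen // inE orbC.
by rewrite (Mho_p_elt 1) // (mem_p_elt G2).
Qed.

Lemma der_sub_Phi : G^`(1) \subset 'Phi(G).
Proof. by rewrite (Phi_joing G2) joing_subl. Qed.

Lemma commg_in_Phi u v : u \in G -> v \in G -> [~ u, v] \in 'Phi(G).
Proof. by move=> Gu Gv; rewrite (subsetP der_sub_Phi) // mem_commg. Qed.

End FrattiniTwoGroup.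

(** * Commutator calculus when the Frattini subgroup is central *)

Section FrattiniCentral.

Variables (gT : finGroupType) (G : {group gT}).
Hypotheses (G2 : 2.-group G) (PhiZ : 'Phi(G) \subset 'Z(G)).

Lemma Phi_commute u z : u \in G -> z \in 'Phi(G) -> commute u z.
Proof. by move=> Gu /(subsetP PhiZ)/centerP[_]/(_ _ Gu)/commute_sym. Qed.

Lemma commgMl u v s : u \in G -> v \in G -> s \in G ->
  [~ u * v, s] = [~ u, s] * [~ v, s].
Proof.
move=> Gu Gv Gs; rewrite commMgJ conjgE.
by rewrite -(Phi_commute Gv) ?(commg_in_Phi G2) // mulKg.
Qed.

Lemma commgMr u v s : u \in G -> v \in G -> s \in G ->
  [~ s, u * v] = [~ s, u] * [~ s, v].
Proof.
move=> Gu Gv Gs; rewrite -[LHS]invgK invg_comm commgMl // invMg !invg_comm.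
by apply: Phi_commute; [apply: groupR | apply: commg_in_Phi].
Qed.

Lemma commgXl u s n : u \in G -> s \in G -> [~ u ^+ n, s] = [~ u, s] ^+ n.
Proof.
by move=> Gu Gs; apply/commXg/Phi_commute => //; rewrite (commg_in_Phi G2).
Qed.

Lemma commgXr u s n : u \in G -> s \in G -> [~ s, u ^+ n] = [~ s, u] ^+ n.
Proof. by move=> Gu Gs; rewrite -[LHS]invgK invg_comm commgXl // -expgVn invg_comm. Qed.

Lemma commg_Phil z u : z \in 'Phi(G) -> u \in G -> [~ z, u] = 1.
Proof. by move=> Pz Gu; apply/eqP/commgP/commute_sym/Phi_commute. Qed.

Lemma commg_Phir z u : z \in 'Phi(G) -> u \in G -> [~ u, z] = 1.
Proof. by move=> Pz Gu; apply/eqP/commgP/Phi_commute. Qed.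

Lemma expgM_Phi u z n : u \in G -> z \in 'Phi(G) -> (u * z) ^+ n = u ^+ n * z ^+ n.
Proof. by move=> Gu Pz; rewrite expgMn //; apply: Phi_commute. Qed.

Lemma commg_sqr u v : u \in G -> v \in G -> [~ u, v] ^+ 2 = 1.
Proof. by move=> Gu Gv; rewrite -commgXl // commg_Phil // (sqr_in_Phi G2). Qed.

Lemma commg_sym u v : u \in G -> v \in G -> [~ v, u] = [~ u, v].
Proof.
move=> Gu Gv; rewrite -invg_comm; apply: (mulgI [~ u, v]).
by rewrite mulgV -expg2 commg_sqr.
Qed.

Lemma sqrgM u v : u \in G -> v \in G ->
  (u * v) ^+ 2 = u ^+ 2 * v ^+ 2 * [~ u, v].
Proof.
move=> Gu Gv; rewrite -(commg_sym Gu Gv) expMg_Rmul ?bin2 ?expg1 //.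
all: by apply: Phi_commute; rewrite ?(commg_in_Phi G2).
Qed.

(** * Two-generator non-abelian subgroups are minimal non-abelian *)

Section TwoGenerators.

Variables u v : gT.
Hypotheses (Gu : u \in G) (Gv : v \in G).

Lemma phi2_sub_Phi : phi2 u v \subset 'Phi(G).
Proof.
by rewrite gen_subG; apply/subsetP=> z; rewrite !inE -orbA => /or3P[]/eqP->;
  rewrite ?(sqr_in_Phi G2) ?(commg_in_Phi G2).
Qed.

Lemma phi2_sqrl : u ^+ 2 \in phi2 u v. Proof. by rewrite mem_gen ?inE ?eqxx. Qed.
Lemma phi2_sqrr : v ^+ 2 \in phi2 u v. Proof. by rewrite mem_gen ?inE ?eqxx ?orbT. Qed.
Lemma phi2_commg : [~ u, v] \in phi2 u v. Proof. by rewrite mem_gen ?inE ?eqxx ?orbT. Qed.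

Lemma phi2_sub (B : {group gT}) :
  u ^+ 2 \in B -> v ^+ 2 \in B -> [~ u, v] \in B -> phi2 u v \subset B.
Proof.
move=> Bu Bv Bc; rewrite gen_subG; apply/subsetP=> z.
by rewrite !inE -orbA => /or3P[]/eqP->.
Qed.

Lemma phi2_sub_gen : phi2 u v \subset <<[set u; v]>>.
Proof.
by apply: phi2_sub; rewrite ?groupX ?groupR // mem_gen ?inE ?eqxx ?orbT.
Qed.

Lemma gen2_sub : <<[set u; v]>> \subset G.
Proof. by rewrite gen_subG; apply/subsetP=> z; rewrite !inE => /orP[]/eqP->. Qed.

Lemma phi2_central : phi2 u v \subset 'Z(<<[set u; v]>>).
Proof.
rewrite subsetI phi2_sub_gen (subset_trans phi2_sub_Phi) //.
by rewrite (subset_trans PhiZ) // subIset // centS ?orbT // gen2_sub.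
Qed.

(** Modulo [phi2 u v] the images of u and v commute and have order at most 2, so the quotient is a
    product of two such cyclic groups. *)
Lemma quotient_gen2_card : (#|<<[set u; v]>> / phi2 u v| <= 4)%N.
Proof.
have nA : <<[set u; v]>> \subset 'N(phi2 u v).
  by rewrite cents_norm // centsC (subset_trans phi2_central) ?subsetIr.
have [nu nv] : u \in 'N(phi2 u v) /\ v \in 'N(phi2 u v).
  by split; apply: (subsetP nA); rewrite mem_gen // !inE eqxx ?orbT.
have o2 s : s \in 'N(phi2 u v) -> s ^+ 2 \in phi2 u v ->
    (#|<[coset (phi2 u v) s]>| <= 2)%N.
  move=> ns s2; rewrite dvdn_leq // -orderE order_dvdn -morphX //=.
  by rewrite coset_id.
have cuv : commute (coset (phi2 u v) u) (coset (phi2 u v) v).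
  by apply/commgP; rewrite -morphR //= coset_id // phi2_commg.
have -> : <<[set u; v]>> / phi2 u v = <[coset (phi2 u v) u]> * <[coset (phi2 u v) v]>.
  rewrite -cent_joinEl ?cent_cycle ?cycle_subG; last exact/cent1P.
  rewrite quotient_gen; last by rewrite -gen_subG.
  rewrite /quotient morphimU !morphim_set1 // joing_idl joing_idr //.
apply: leq_trans (leq_pmulr _ (cardG_gt0 (<[coset (phi2 u v) u]> :&: <[coset (phi2 u v) v]>))) _.
by rewrite -mul_cardG (leq_mul (n1 := 2) (n2 := 2)) ?o2 ?phi2_sqrl ?phi2_sqrr.
Qed.

Hypothesis uv : [~ u, v] != 1.

Lemma gen2_nonabelian : ~~ abelian <<[set u; v]>>.
Proof.
rewrite abelian_gen; apply: contra uv => /centsP/(_ u _ v) cuv.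
by apply/commgP/cuv; rewrite !inE eqxx ?orbT.
Qed.

Lemma quotient_gen2_card_eq : #|<<[set u; v]>> / phi2 u v| = 4.
Proof.
have H2 : 2.-group <<[set u; v]>> by apply: pgroupS gen2_sub G2.
apply/eqP; rewrite eqn_leq quotient_gen2_card leqNgt.
(* Order below 4 makes the quotient by the central subgroup [phi2 u v] cyclic, and a
   central-by-cyclic group is abelian. *)
apply: contra gen2_nonabelian => lt4.
apply: cyclic_factor_abelian phi2_central _; apply: (dvdn_prime_cyclic (p := 2)) => //.
have := card_pgroup (quotient_pgroup (phi2 u v) H2).
move: lt4 => /[swap] ->; case: (logn _ _) => [|[|n]] //.
by rewrite 2!expnS mulnA ltnNge leq_pmulr ?expn_gt0.
Qed.

Lemma card_gen2 : #|<<[set u; v]>>| = (4 * #|phi2 u v|)%N.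
Proof.
have nA : <<[set u; v]>> \subset 'N(phi2 u v).
  by rewrite cents_norm // centsC (subset_trans phi2_central) ?subsetIr.
have := quotient_gen2_card_eq; rewrite card_quotient // => <-.
by rewrite mulnC Lagrange ?phi2_sub_gen.
Qed.

(** For a non-abelian K in H = <u, v>, the join of K with the central [phi2 u v] has a quotient of
    order at least 4, hence equals H. As [phi2 u v] lies in the Frattini subgroup of H, K alone is
    already H. *)
Lemma gen2_A1 : A1_group <<[set u; v]>>.
Proof.
rewrite /A1_group gen2_nonabelian; apply/forallP=> K; apply/implyP=> KH.
apply: contraR (proper_subn KH) => nabK.
have nA : <<[set u; v]>> \subset 'N(phi2 u v).
  by rewrite cents_norm // centsC (subset_trans phi2_central) ?subsetIr.
have H2 : 2.-group <<[set u; v]>> by apply: pgroupS gen2_sub G2.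
have sKH := proper_sub KH.
have nAK : K \subset 'N(phi2 u v) := subset_trans sKH nA.
have A_Phi : phi2 u v \subset 'Phi(<<[set u; v]>>).
  by apply: phi2_sub; rewrite ?(sqr_in_Phi H2) ?(commg_in_Phi H2) // mem_gen ?inE ?eqxx ?orbT.
have sAK : phi2 u v \subset phi2 u v <*> K := joing_subl _ _.
have sAKH : phi2 u v <*> K \subset <<[set u; v]>> by rewrite join_subG phi2_sub_gen.
have nabAK : ~~ abelian (phi2 u v <*> K).
  by apply: contra nabK => /(abelianS (joing_subr _ _)).
have q4 : (4 <= #|phi2 u v <*> K / phi2 u v|)%N.
  rewrite leqNgt; apply: contra nabAK => lt4.
  have cA : phi2 u v \subset 'Z(phi2 u v <*> K).
    rewrite subsetI sAK (subset_trans phi2_central) // subIset // centS ?orbT //.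
  apply: cyclic_factor_abelian cA _; apply: (dvdn_prime_cyclic (p := 2)) => //.
  have := card_pgroup (quotient_pgroup (phi2 u v) (pgroupS sAKH H2)).
  move: lt4 => /[swap] ->; case: (logn _ _) => [|[|n]] //.
  by rewrite 2!expnS mulnA ltnNge leq_pmulr ?expn_gt0.
have eqH : phi2 u v <*> K = <<[set u; v]>>.
  apply/eqP; rewrite eqEcard sAKH -(Lagrange sAK) -(Lagrange phi2_sub_gen).
  rewrite leq_pmul2l ?cardG_gt0 // -!card_quotient ?quotient_gen2_card_eq //.
  by rewrite join_subG normG.
rewrite -{1}(Phi_nongen (G := <<[set u; v]>>) (X := K)) ?genGid //.
apply/eqP; rewrite eqEsubset join_subG Phi_sub sKH /= -{1}eqH.
by rewrite genS // setSU.
Qed.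

End TwoGenerators.
End FrattiniCentral.

(** * Boolean triples as a computable model of F_2^3 *)

Definition vec := (bool * bool * bool)%type.

Definition vec_add (s t : vec) : vec :=
  let: (s1, s2, s3) := s in let: (t1, t2, t3) := t in
  (s1 (+) t1, s2 (+) t2, s3 (+) t3).

Definition vec_scale (c : bool) (s : vec) : vec :=
  let: (s1, s2, s3) := s in (c && s1, c && s2, c && s3).

Definition vec_cross (s t : vec) : vec :=
  let: (s1, s2, s3) := s in let: (t1, t2, t3) := t in
  (s2 && t3 (+) s3 && t2, s3 && t1 (+) s1 && t3, s1 && t2 (+) s2 && t1).

Definition vec0 : vec := (false, false, false).

Definition bools := [:: false; true].

Definition all_vecs : seq vec :=
  [seq (t, r) | t <- [seq (p, q) | p <- bools, q <- bools], r <- bools].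

Definition lincomb (a b c t : vec) : vec :=
  let: (p, q, r) := t in vec_add (vec_scale p a) (vec_add (vec_scale q b) (vec_scale r c)).

(** Removing duplicates makes the size of the list the order of the span. *)
Definition span3 (a b c : vec) : seq vec := undup [seq lincomb a b c t | t <- all_vecs].

Lemma mem_all_vecs t : t \in all_vecs.
Proof. by case: t => [[[] []] []]. Qed.

Lemma has_vecsP (P : vec -> vec -> bool) :
  reflect (exists u v, P u v) (has (fun u => has (P u) all_vecs) all_vecs).
Proof.
apply: (iffP hasP) => [[u _ /hasP[v _ Puv]]|[u [v Puv]]]; first by exists u, v.
by exists u; rewrite ?mem_all_vecs //; apply/hasP; exists v; rewrite ?mem_all_vecs.
Qed.


Lemma span3P a b c s : reflect (exists t, s = lincomb a b c t) (s \in span3 a b c).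
Proof.
rewrite mem_undup; apply: (iffP mapP) => [[t _ ->]|[t ->]]; first by exists t.
by exists t; rewrite ?mem_all_vecs.
Qed.

Lemma lincombD a b c s t :
  vec_add (lincomb a b c s) (lincomb a b c t) = lincomb a b c (vec_add s t).
Proof.
have coordD x y z p q r p' q' r' :
    p && x (+) (q && y (+) r && z) (+) (p' && x (+) (q' && y (+) r' && z)) =
    (p (+) p') && x (+) ((q (+) q') && y (+) (r (+) r') && z).
  by case: x y z => [] [] []; case: p p' => [] []; case: q q' => [] []; case: r r' => [] [].
by case: a b c s t => [[? ?] ?] [[? ?] ?] [[? ?] ?] [[? ?] ?] [[? ?] ?] /=; rewrite !coordD.
Qed.

Lemma expg_odd (gT : finGroupType) (g : gT) n : g ^+ 2 = 1 -> g ^+ n = g ^+ (odd n).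
Proof. by move=> g2; rewrite -{1}(odd_double_half n) expgD -muln2 mulnC expgM g2 expg1n mulg1. Qed.

(** * Coordinates on G and on G' *)

Section Coordinates.

Variables (gT : finGroupType) (G : {group gT}) (m : nat) (a1 a2 a3 : gT).
Variables (r1 r2 r3 : vec).
Hypotheses (G2 : 2.-group G) (PhiZ : 'Phi(G) \subset 'Z(G)).
Hypotheses (derG_abelem : 2.-abelem G^`(1)) (derG_card : #|G^`(1)| = 8).
Hypothesis m_gt1 : (1 < m)%N.
Hypotheses (Ga1 : a1 \in G) (Ga2 : a2 \in G) (Ga3 : a3 \in G).
Hypothesis dec : <[coset G^`(1) a1]> \x <[coset G^`(1) a2]> \x <[coset G^`(1) a3]>
  = G / G^`(1).
Hypotheses (o1 : #[coset G^`(1) a1] = (2 ^ m)%N) (o2 : #[coset G^`(1) a2] = 2)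
  (o3 : #[coset G^`(1) a3] = 2).

Definition nu (s : vec) : gT :=
  let: (p, q, r) := s in [~ a2, a3] ^+ p * [~ a3, a1] ^+ q * [~ a1, a2] ^+ r.

Hypotheses (pow1 : a1 ^+ (2 ^ m) = nu r1) (pow2 : a2 ^+ 2 = nu r2)
  (pow3 : a3 ^+ 2 = nu r3).

Local Notation Phi_comm := (Phi_commute PhiZ).

Lemma nu_der s : nu s \in G^`(1).
Proof. by case: s => [[p q] r]; rewrite !groupM ?groupX ?mem_commg. Qed.

Lemma nu_Phi s : nu s \in 'Phi(G).
Proof. exact: subsetP (der_sub_Phi G2) _ (nu_der s). Qed.

Lemma nu_in s : nu s \in G. Proof. exact: subsetP (Phi_sub G) _ (nu_Phi s). Qed.

Lemma nuD s t : nu (vec_add s t) = nu s * nu t.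
Proof.
case: s t => [[p q] r] [[p' q'] r'] /=.
have ab (g : gT) (b c : bool) : g ^+ 2 = 1 -> g ^+ (b (+) c) = g ^+ b * g ^+ c.
  by move=> g2; rewrite -expgD (expg_odd (b + c) g2) oddD !oddb.
rewrite !ab ?(commg_sqr G2 PhiZ) //.
set X := [~ a2, a3]; set Y := [~ a3, a1]; set Z := [~ a1, a2].
have cX n g : g \in G -> X ^+ n * g = g * X ^+ n.
  by move=> Gg; symmetry; apply: Phi_comm => //; rewrite groupX ?(commg_in_Phi G2).
have cY n g : g \in G -> Y ^+ n * g = g * Y ^+ n.
  by move=> Gg; symmetry; apply: Phi_comm => //; rewrite groupX ?(commg_in_Phi G2).
have GZ : Z \in G by rewrite groupR.
have GY : Y \in G by rewrite groupR.
rewrite -!mulgA; congr (_ * _).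
rewrite [in RHS]mulgA [RHS]mulgA -cX ?groupM ?groupX // -!mulgA; congr (_ * (_ * _)).
by rewrite mulgA cY ?groupX // mulgA.
Qed.

Lemma nu0 : nu vec0 = 1. Proof. by rewrite /= !mulg1. Qed.

Lemma nuX s n : nu s ^+ n = nu (vec_scale (odd n) s).
Proof.
have nu2 : nu s ^+ 2 = 1.
  by rewrite expg2 -nuD -nu0; congr nu; case: s => [[[] []] []].
by rewrite (expg_odd n nu2); case: (odd n); case: s {nu2} => [[p q] r] //=; rewrite !mulg1.
Qed.

(** The exponents of a2 and a3 are booleans because their squares lie in G'. *)
Definition word (i : nat) (j k : bool) : gT := a1 ^+ i * a2 ^+ j * a3 ^+ k.

Lemma word_in i j k : word i j k \in G.
Proof. by rewrite !groupM ?groupX. Qed.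

Let xE n : [~ a2, a3] ^+ n = nu (odd n, false, false).
Proof. by rewrite /= !mulg1 expg_odd ?(commg_sqr G2 PhiZ). Qed.
Let yE n : [~ a3, a1] ^+ n = nu (false, odd n, false).
Proof. by rewrite /= mulg1 mul1g expg_odd ?(commg_sqr G2 PhiZ). Qed.
Let zE n : [~ a1, a2] ^+ n = nu (false, false, odd n).
Proof. by rewrite /= !mul1g expg_odd ?(commg_sqr G2 PhiZ). Qed.

Let commgMl := commgMl G2 PhiZ.
Let commgMr := commgMr G2 PhiZ.
Let commgXl := commgXl G2 PhiZ.
Let commgXr := commgXr G2 PhiZ.
Let commg_sym := commg_sym G2 PhiZ.

(** Commutators are bilinear and square to 1, so only the parity of the exponent of a1 counts; with
    x, y, z in cyclic order the form is the cross product. *)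
Lemma commg_word i j k i' j' k' :
  [~ word i j k, word i' j' k'] = nu (vec_cross (odd i, j, k) (odd i', j', k')).
Proof.
rewrite /word !(commgMl, commgMr) ?groupM ?groupX //.
rewrite !(commgXl, commgXr) ?groupX // !commgg !expg1n.
rewrite (commg_sym Ga1 Ga2) (commg_sym Ga3 Ga1) (commg_sym Ga2 Ga3).
rewrite -!expgM !xE !yE !zE -nu0 -!nuD; congr nu; rewrite !oddM !oddb.
by case: (odd i) (odd i') j k j' k' => [] [] [] [] [] [].
Qed.

(** The factor of the square of a word that lies in G', with [i] the parity of the exponent of a1.
    The last triple collects the commutators that arise from squaring a product. *)
Definition sqr_defect (i j k : bool) : vec :=
  vec_add (vec_add (vec_scale j r2) (vec_scale k r3)) (j && k, i && k, i && j).

Lemma sqr_word i j k :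
  word i j k ^+ 2 = a1 ^+ (2 * i) * nu (sqr_defect (odd i) j k).
Proof.
rewrite /word !(sqrgM G2 PhiZ) ?groupM ?groupX //.
rewrite !(commgMl, commgMr) ?groupM ?groupX //.
rewrite !(commgXl, commgXr) ?groupX // (commg_sym Ga3 Ga1).
rewrite -!expgM (mulnC i) !(mulnC _ 2) !(expgM _ 2) pow2 pow3 -!mulgA; congr (_ * _).
rewrite !xE !yE !zE !nuX -!nuD; congr nu; rewrite !oddb /sqr_defect ?oddM ?oddb.
by case: r2 r3 => [[[] []] []] [[[] []] []]; case: (odd i) j k => [] [] [].
Qed.

Lemma word_der g : g \in G ->
  exists i j k, exists2 h, h \in G^`(1) & g = word i j k * h.
Proof.
move=> Gg; have nG : {subset G <= 'N(G^`(1))} := subsetP (der_norm 1 G).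
case/dprodP: (dec) => [[K _ defK _] decE _ _].
have := mem_quotient G^`(1) Gg; rewrite -decE defK -(dprodW defK).
case/mulsgP=> _ _ /mulsgP[_ _ /cycleP[i ->] /cycleP[j ->] ->] /cycleP[k ->].
rewrite (expg_odd j) -?o2 ?expg_order // (expg_odd k) -?o3 ?expg_order //.
rewrite -!morphX ?nG //= -!morphM ?nG ?groupM ?groupX //= -/(word _ _ _) => gE.
exists i, (odd j), (odd k), ((word i (odd j) (odd k))^-1 * g); last by rewrite mulKVg.
have Gw := word_in i (odd j) (odd k).
apply: coset_idr; rewrite ?nG ?groupM ?groupV //.
by rewrite morphM ?morphV ?nG ?groupV //= gE mulVg.
Qed.

Lemma der_Phi h : h \in G^`(1) -> h \in 'Phi(G).
Proof. exact: subsetP (der_sub_Phi G2) h. Qed.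

Lemma commg_mul_der u v h h' : u \in G -> v \in G -> h \in G^`(1) -> h' \in G^`(1) ->
  [~ u * h, v * h'] = [~ u, v].
Proof.
move=> Gu Gv dh dh'; have [Ph Ph'] := (der_Phi dh, der_Phi dh').
have [Gh Gh'] : h \in G /\ h' \in G by split; apply: (subsetP (Phi_sub G)).
rewrite !(commgMl, commgMr) ?groupM //.
by rewrite !(commg_Phil PhiZ Ph) ?(commg_Phir PhiZ Ph') ?mulg1.
Qed.

Lemma sqr_mul_der u h : u \in G -> h \in G^`(1) -> (u * h) ^+ 2 = u ^+ 2.
Proof.
move=> Gu dh; rewrite (expgM_Phi PhiZ) ?der_Phi //.
by case/(abelemP (isT : prime 2)): (derG_abelem) => _ /(_ h dh) ->; rewrite mulg1.
Qed.

(** The image of [nu] is a subgroup, and every commutator of G is a commutator of two words, since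
    the factors from G' are central. *)
Lemma nu_surj h : h \in G^`(1) -> exists s, h = nu s.
Proof.
have gK : group_set (nu @: [set: vec]).
  apply/group_setP; split=> [|_ _ /imsetP[s _ ->] /imsetP[t _ ->]].
    by rewrite -nu0 imset_f.
  by rewrite -nuD imset_f.
suff /subsetP sub : G^`(1) \subset Group gK.
  by move/sub/imsetP=> [s _ ->]; exists s.
rewrite gen_subG; apply/subsetP=> _ /imset2P[u v Gu Gv ->].
have [i [j [k [h1 dh1 ->]]]] := word_der Gu.
have [i' [j' [k' [h1' dh1' ->]]]] := word_der Gv.
by rewrite commg_mul_der ?word_in // commg_word imset_f.
Qed.

(** By surjectivity the image has 8 elements, as many as there are vectors. *)
Lemma nu_inj : injective nu.
Proof.
suff /imset_injP inj : #|nu @: [set: vec]| == #|[set: vec]|.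
  by move=> s t; apply: inj; rewrite inE.
rewrite eqn_leq leq_imset_card cardsT !card_prod !card_bool.
rewrite -[leqLHS]derG_card subset_leq_card //.
by apply/subsetP=> h /nu_surj[s ->]; rewrite imset_f.
Qed.

Lemma card_coordinates : #|G| = (2 ^ (m + 5))%N.
Proof.
rewrite -(Lagrange (der_sub 1 G)) -card_quotient ?der_norm // derG_card.
case/dprodP: (dec) => [[K _ defK _] _ _ _].
rewrite -(dprod_card dec) defK -(dprod_card defK) -!orderE o1 o2 o3.
by rewrite expnD mulnC -!mulnA.
Qed.

Lemma gen_nuE a b c :
  <<[set nu a; nu b; nu c]>> = nu @: [set s in span3 a b c].
Proof.
have inS t : nu (lincomb a b c t) \in nu @: [set s in span3 a b c].
  by rewrite imset_f // inE; apply/span3P; exists t.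
have gS : group_set (nu @: [set s in span3 a b c]).
  apply/group_setP; split.
    rewrite -nu0 (_ : vec0 = lincomb a b c vec0) ?inS //.
    by case: a b c {inS} => [[? ?] ?] [[? ?] ?] [[? ?] ?].
  move=> _ _ /imsetP[s + ->] /imsetP[t + ->].
  by rewrite !inE => /span3P[s' ->] /span3P[t' ->]; rewrite -nuD lincombD inS.
apply/eqP; rewrite eqEsubset (_ : nu @: _ = Group gS) // gen_subG; apply/andP; split.
  have := (inS (true, false, false), inS (false, true, false), inS (false, false, true)).
  have -> : lincomb a b c (true, false, false) = a.
    by case: (a) (b) (c) => [[? ?] ?] [[? ?] ?] [[? ?] ?]; rewrite /= !addbF.
  have -> : lincomb a b c (false, true, false) = b.
    by case: (a) (b) (c) => [[? ?] ?] [[? ?] ?] [[? ?] ?]; rewrite /= !addbF.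
  have -> : lincomb a b c (false, false, true) = c.
    by case: (a) (b) (c) => [[? ?] ?] [[? ?] ?] [[? ?] ?].
  by move=> [[Sa Sb] Sc]; apply/subsetP=> z; rewrite !inE -orbA => /or3P[] /eqP->.
apply/subsetP=> _ /imsetP[s + ->]; rewrite inE => /span3P[[[p q] r] ->].
rewrite /lincomb !nuD -[p]oddb -[q]oddb -[r]oddb -!nuX.
by rewrite !groupM ?groupX // mem_gen // !inE eqxx ?orbT.
Qed.

Lemma card_gen_nu a b c : #|<<[set nu a; nu b; nu c]>>| = size (span3 a b c).
Proof. by rewrite gen_nuE card_imset ?cardsE ?(card_uniqP (undup_uniq _)) //; apply: nu_inj. Qed.

Lemma gen_nu_sub (B : {group gT}) a b c :
  nu a \in B -> nu b \in B -> nu c \in B -> <<[set nu a; nu b; nu c]>> \subset B.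
Proof.
move=> Ba Bb Bc; rewrite gen_subG; apply/subsetP=> z.
by rewrite !inE -orbA => /or3P[]/eqP->.
Qed.

Lemma nu_neq1 s : (nu s != 1) = (s != vec0).
Proof. by rewrite -nu0 (inj_eq nu_inj). Qed.

Lemma index_gen2 u v : u \in G -> v \in G -> [~ u, v] != 1 ->
  (#|G : <<[set u; v]>>| * #|phi2 u v| = 2 ^ (m + 3))%N.
Proof.
move=> Gu Gv uv; apply/eqP; rewrite -(eqn_pmul2l (isT : (0 < 4)%N)).
rewrite (mulnC #|_ : _|) mulnA -(card_gen2 G2 PhiZ) // (Lagrange (gen2_sub Gu Gv)).
by rewrite card_coordinates -(expnD 2 2) addnCA.
Qed.

Lemma phi2C u v : u \in G -> v \in G -> phi2 u v = phi2 v u :> {set gT}.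
Proof. by move=> Gu Gv; rewrite /= (commg_sym Gu Gv) (setUC [set u ^+ 2]). Qed.

(** The substitution of v u^n for v normalises the second generator; a further power of u undoes
    it. *)
Lemma phi2_mulX u v n : u \in G -> v \in G -> phi2 u (v * u ^+ n) \subset phi2 u v.
Proof.
move=> Gu Gv; have Ac := phi2_commg u v.
apply: phi2_sub; first exact: phi2_sqrl.
  rewrite (sqrgM G2 PhiZ) ?groupX // commgXr // (commg_sym Gu Gv).
  rewrite expgAC; apply: groupM; last exact: groupX.
  by apply: groupM; [apply: phi2_sqrr | apply/groupX/phi2_sqrl].
by rewrite commgMr ?groupX // commgXr // commgg expg1n mulg1.
Qed.

(** * Squares modulo G' and normal forms of elements with square in G' *)

Let f := coset G^`(1).

Lemma mem_der g : g \in G -> (g \in G^`(1)) = (f g == 1).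
Proof.
move=> Gg; have Ng : g \in 'N(G^`(1)) := subsetP (der_norm 1 G) g Gg.
by apply/idP/eqP => [/coset_id|/coset_idr]; last exact.
Qed.

Lemma coset_sqr_word i j k : f (word i j k) ^+ 2 = f a1 ^+ (2 * i).
Proof.
have nG : {subset G <= 'N(G^`(1))} := subsetP (der_norm 1 G).
rewrite -!morphX ?nG ?word_in //= sqr_word morphM ?nG ?groupX ?nu_in //=.
by rewrite [coset _ (nu _)]coset_id ?mulg1 // nu_der.
Qed.

Lemma coset_sqr_mulX u v n : u \in G -> v \in G ->
  f (v * u ^+ n) ^+ 2 = f v ^+ 2 * (f u ^+ 2) ^+ n.
Proof.
move=> Gu Gv; have nG : {subset G <= 'N(G^`(1))} := subsetP (der_norm 1 G).
have cfuv : commute (f v) (f u).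
  by apply: (centsP (der_abelian 0 G)); apply: mem_quotient.
rewrite /f morphM ?morphX ?nG ?groupX //= expgMn; last exact: commuteX.
by rewrite expgAC.
Qed.

Lemma mem_der_sqr g : g \in G -> (g ^+ 2 \in G^`(1)) = (f g ^+ 2 == 1).
Proof.
move=> Gg; have Ng : g \in 'N(G^`(1)) := subsetP (der_norm 1 G) g Gg.
by rewrite mem_der ?groupX // /f morphX.
Qed.

(** Here (s, j, k) stands for the word in which a1 has exponent 2^(m-1) s: a1 contributes a1^(2^m s)
    to the square, and its exponent is even because 1 < m, whence [false]. *)
Definition sqr_vec (u : vec) : vec :=
  let: (s, j, k) := u in vec_add (vec_scale s r1) (sqr_defect false j k).

(** The first component of a vector records the multiple of 2^(m-1); for commutators the parity of
    the exponent of a1 is put in its place. *)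
Definition with_fst (p : bool) (u : vec) : vec := let: (_, j, k) := u in (p, j, k).

Lemma pow1X n : a1 ^+ (2 ^ m * n) = nu (vec_scale (odd n) r1).
Proof. by rewrite expgM pow1 nuX. Qed.

Lemma sqr_word_half s j k :
  word (2 ^ m.-1 * s) j k ^+ 2 = nu (sqr_vec (odd s, j, k)).
Proof.
rewrite sqr_word mulnA -expnS prednK ?(ltnW m_gt1) // pow1X -nuD.
by case: m m_gt1 => [|[|n]] //= _; rewrite expnS -mulnA oddM.
Qed.

Lemma sqr_word_odd i j k n : ~~ odd n -> (word i j k ^+ 2) ^+ n = a1 ^+ (2 * i * n).
Proof.
move=> evn; rewrite sqr_word (expgM_Phi PhiZ) ?groupX ?nu_Phi // -expgM nuX (negPf evn).
by rewrite (_ : vec_scale false _ = vec0) ?nu0 ?mulg1 //; case: (sqr_defect _ _ _) => [[]].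
Qed.

Lemma word_der_sqr u : u \in G -> exists i j k, exists2 h, h \in G^`(1) &
  [/\ u = word i j k * h, u ^+ 2 = word i j k ^+ 2 & f u ^+ 2 = f a1 ^+ (2 * i)].
Proof.
move=> Gu; have nG : {subset G <= 'N(G^`(1))} := subsetP (der_norm 1 G).
have [i [j [k [h dh ->]]]] := word_der Gu.
exists i, j, k; exists h => //; split=> //; first by rewrite sqr_mul_der ?word_in.
have Gwh : word i j k * h \in G by rewrite groupM ?word_in ?(subsetP (der_sub 1 G)).
by rewrite -(coset_sqr_word i j k) /f -!morphX ?nG ?word_in //= sqr_mul_der ?word_in.
Qed.

(** Modulo G' the square of u is a1^(2i), and the coset of a1 has order 2^m, so 2^(m-1) divides
    i. *)
Lemma sqr_der_word u : u \in G -> u ^+ 2 \in G^`(1) ->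
  exists s j k, exists2 h, h \in G^`(1) &
    u = word (2 ^ m.-1 * s) j k * h /\ u ^+ 2 = nu (sqr_vec (odd s, j, k)).
Proof.
move=> Gu; rewrite mem_der_sqr //; have [i [j [k [h dh [uE u2 ->]]]]] := word_der_sqr Gu.
rewrite -order_dvdn o1 -{1}(prednK (ltnW m_gt1)) expnS dvdn_pmul2l // => /dvdnP[s iE].
exists s, j, k; exists h => //; rewrite -sqr_word_half; move: uE u2; rewrite iE mulnC.
by split.
Qed.

Lemma odd_half s : odd (2 ^ m.-1 * s) = false.
Proof. by case: m m_gt1 => [|[|n]] //= _; rewrite expnS -mulnA oddM. Qed.

(** Coordinates of u^2, v^2 and [u, v] when both exponents of a1 are multiples of 2^(m-1), hence
    even. *)
Definition even_span (u v : vec) : seq vec :=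
  span3 (sqr_vec u) (sqr_vec v) (vec_cross (with_fst false u) (with_fst false v)).

(* The span of a1^(2^m), v^2 and [u, v], where p is the parity of the exponent
   of a1 in u, the first component of u being ignored. *)
Definition odd_span (p : bool) (u v : vec) : seq vec :=
  span3 r1 (sqr_vec v) (vec_cross (with_fst p u) (with_fst false v)).

Definition even_word (u : vec) : gT := let: (s, j, k) := u in word (2 ^ m.-1 * s) j k.

Lemma even_word_in u : even_word u \in G.
Proof. by case: u => [[s j] k]; apply: word_in. Qed.

Lemma sqr_even_word u : even_word u ^+ 2 = nu (sqr_vec u).
Proof. by case: u => [[s j] k]; rewrite sqr_word_half oddb. Qed.

Lemma commg_even_word i j k s v :
  [~ word i j k, even_word v] = nu (vec_cross (odd i, j, k) (with_fst false v)) /\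
  [~ even_word (s, j, k), even_word v] = nu (vec_cross (false, j, k) (with_fst false v)).
Proof. by case: v => [[s' j'] k']; rewrite !commg_word !odd_half. Qed.

Lemma card_phi2_even_word u v :
  #|phi2 (even_word u) (even_word v)| = size (even_span u v).
Proof.
rewrite -card_gen_nu /= !sqr_even_word.
by case: u => [[s j] k]; have [_ ->] := commg_even_word 0 j k s v.
Qed.

Lemma phi2_even u v : u \in G -> v \in G -> u ^+ 2 \in G^`(1) -> v ^+ 2 \in G^`(1) ->
  exists u' v', [~ u, v] = nu (vec_cross (with_fst false u') (with_fst false v')) /\
   #|phi2 u v| = size (even_span u' v').
Proof.
move=> Gu Gv /(sqr_der_word Gu)[s [j [k [h dh [uE u2]]]]].
move=> /(sqr_der_word Gv)[s' [j' [k' [h' dh' [vE v2]]]]].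
exists (odd s, j, k), (odd s', j', k').
have cE : [~ u, v] = nu (vec_cross (false, j, k) (false, j', k')).
  by rewrite uE vE commg_mul_der ?word_in // commg_word !odd_half.
by split=> //; rewrite -card_gen_nu /= u2 v2 cE.
Qed.

(** * Lower bounds on the order of [phi2 u v] *)

Lemma phi2_der_card_gt1 u v : u \in G -> v \in G -> [~ u, v] != 1 ->
  (1 < #|phi2 u v :&: G^`(1)|)%N.
Proof.
move=> Gu Gv uv; rewrite cardG_gt1; apply/trivgPn; exists [~ u, v] => //.
by rewrite inE phi2_commg mem_commg.
Qed.

Lemma phi2_pgroup u v : u \in G -> v \in G -> 2.-group (phi2 u v).
Proof. by move=> Gu Gv; apply: pgroupS (subset_trans (phi2_sub_Phi G2 Gu Gv) (Phi_sub G)) G2. Qed.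

(** The order is at most 2, and [phi2 u v] meets G' in the nontrivial [u, v]. *)
Lemma phi2_sub_der u v : u \in G -> v \in G -> [~ u, v] != 1 ->
  (#|phi2 u v| < 4)%N -> phi2 u v \subset G^`(1).
Proof.
move=> Gu Gv uv lt4; apply/setIidPl/eqP; rewrite eqEcard subsetIl.
rewrite (leq_trans (card_pgroup_le (k := 1) _ (phi2_pgroup Gu Gv) lt4)) //.
exact: phi2_der_card_gt1.
Qed.

Lemma phi2_ge4 : (forall u v, vec_cross (with_fst false u) (with_fst false v) != vec0 ->
    4 <= size (even_span u v))%N ->
  forall u v, u \in G -> v \in G -> [~ u, v] != 1 -> (4 <= #|phi2 u v|)%N.
Proof.
move=> ge4 u v Gu Gv uv; rewrite leqNgt; apply/negP => lt4.
have /subsetP sub := phi2_sub_der Gu Gv uv lt4.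
have [] := phi2_even Gu Gv (sub _ (phi2_sqrl u v)) (sub _ (phi2_sqrr u v)).
move=> u' [v' [cE cardE]]; move: lt4 uv; rewrite cardE cE nu_neq1 => lt4 /ge4.
by rewrite leqNgt lt4.
Qed.

(** The order is at most 4 and the intersection with G' has order at least 2, so its index is at
    most 2. *)
Lemma expg2_phi2_der u v g : u \in G -> v \in G -> [~ u, v] != 1 ->
  (#|phi2 u v| < 8)%N -> g \in phi2 u v -> g ^+ 2 \in phi2 u v :&: G^`(1).
Proof.
move=> Gu Gv uv lt8 Ag; pose B := (phi2 u v :&: G^`(1))%G; rewrite -[_ :&: _]/(gval B).
have sAG : phi2 u v \subset G := subset_trans (phi2_sub_Phi G2 Gu Gv) (Phi_sub G).
have nBA : phi2 u v \subset 'N(B).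
  by rewrite normsI ?normG // (subset_trans sAG) ?der_norm.
have le2 : (#|phi2 u v / B| <= 2)%N.
  rewrite leqNgt; apply/negP => gt2.
  have := leq_mul (phi2_der_card_gt1 Gu Gv uv) gt2.
  rewrite card_quotient // Lagrange ?subsetIl //.
  move/leq_trans => /(_ _ (card_pgroup_le (k := 2) _ (phi2_pgroup Gu Gv) lt8)).
  by move=> /(_ isT).
apply: coset_idr; first by rewrite groupX // (subsetP nBA).
rewrite morphX ?(subsetP nBA) //=; apply/eqP; rewrite -order_dvdn.
apply: dvdn_trans (order_dvdG (mem_quotient B Ag)) _.
by case: #|_| le2 (cardG_gt0 (phi2 u v / B)) => [|[|[|]]].
Qed.

Lemma sqr_quarter i : f a1 ^+ (4 * i) = 1 -> exists s, i = (2 ^ (m - 2) * s)%N.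
Proof.
move/eqP; rewrite -order_dvdn o1 -{1}(subnK m_gt1) addnC expnD dvdn_pmul2l //.
by move/dvdnP=> [s ->]; exists s; rewrite mulnC.
Qed.

Lemma dvdn_quarter s : ~~ odd s -> (2 ^ m %| 2 * (2 ^ (m - 2) * s))%N.
Proof.
move=> evs; rewrite -{1}(subnK m_gt1) expnD mulnCA dvdn_pmul2l ?expn_gt0 //.
by rewrite -[(2 ^ 2)%N]/(2 * 2)%N dvdn_pmul2l // dvdn2.
Qed.

Lemma odd_quarter s : odd s -> odd (2 ^ (m - 2) * s) = (m == 2).
Proof.
move=> os; rewrite oddM os andbT oddX; case: m m_gt1 => [|[|[|n]]] //= _.
Qed.

(** Since u^4 lies in G' and u^2 does not, the exponent of a1 in u is an odd multiple of 2^(m-2),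
    and u^4 = a1^(2^m). Thus a1^(2^m), v^2 and [u, v] all lie in the intersection of [phi2 u v] with
    G'. *)
Lemma phi2_odd u v : u \in G -> v \in G -> [~ u, v] != 1 ->
    u ^+ 2 \notin G^`(1) -> v ^+ 2 \in G^`(1) -> (#|phi2 u v| < 8)%N ->
  exists u' v', vec_cross (with_fst (m == 2) u') (with_fst false v') != vec0 /\
    (size (odd_span (m == 2) u' v') < 4)%N.
Proof.
move=> Gu Gv uv u2 v2 lt8.
have u4 := expg2_phi2_der Gu Gv uv lt8 (phi2_sqrl u v).
have nG : {subset G <= 'N(G^`(1))} := subsetP (der_norm 1 G).
have [i [j [k [h dh [uE uE2 fu2]]]]] := word_der_sqr Gu.
have [s iE] : exists s, i = (2 ^ (m - 2) * s)%N.
  apply: sqr_quarter; rewrite (mulnAC 2 2) expgM -fu2.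
  case/setIP: u4 => _; rewrite mem_der ?groupX // => /eqP.
  by rewrite /f !morphX ?nG ?groupX.
have os : odd s.
  apply: contraR u2 => evs; rewrite mem_der_sqr // fu2 -order_dvdn o1 iE.
  exact: dvdn_quarter.
have [s' [j' [k' [h' dh' [vE v2E]]]]] := sqr_der_word Gv v2.
(* The leading [false] is a default value, overwritten by [with_fst]. *)
exists (false, j, k), (odd s', j', k').
have cE : [~ u, v] = nu (vec_cross (m == 2, j, k) (false, j', k')).
  by rewrite uE vE commg_mul_der ?word_in // commg_word odd_half iE odd_quarter.
split; first by move: uv; rewrite cE nu_neq1.
have u4E : (u ^+ 2) ^+ 2 = nu r1.
  rewrite uE2 sqr_word_odd // iE.
  have -> : (2 * (2 ^ (m - 2) * s) * 2 = 2 ^ m * s)%N.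
    by rewrite mulnC !mulnA -(expnD 2 2) subnKC.
  by rewrite pow1X os; case: (r1) => [[]].
rewrite /odd_span -card_gen_nu.
have sub : <<[set nu r1; nu (sqr_vec (odd s', j', k'));
                  nu (vec_cross (m == 2, j, k) (false, j', k'))]>>
    \subset phi2 u v :&: G^`(1).
  apply: gen_nu_sub; rewrite inE nu_der andbT.
  - by rewrite -u4E groupX ?phi2_sqrl.
  - by rewrite -v2E phi2_sqrr.
  - by rewrite -cE phi2_commg.
(* As u^2 lies in [phi2 u v] but not in G', the intersection has index at least 2, which halves the
   bound 8. *)
apply: leq_ltn_trans (subset_leq_card sub) _; rewrite -(ltn_pmul2r (isT : (0 < 2)%N)).
apply: leq_ltn_trans lt8.
rewrite -(Lagrange (subsetIl (phi2 u v) G^`(1))) leq_pmul2l ?cardG_gt0 //.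
rewrite indexg_gt1 subsetI subxx /=; apply: contra u2 => /subsetP; apply.
exact: phi2_sqrl.
Qed.

(** If both squares lie in G', the hypothesis on [even_span] applies; if exactly one does,
    [phi2_odd] applies up to swapping; if neither does and the order is below 8, replacing v by v u
    leads back to the mixed case. *)
Lemma phi2_ge8 :
  (forall u v, vec_cross (with_fst false u) (with_fst false v) != vec0 ->
    8 <= size (even_span u v))%N ->
  (forall u v, vec_cross (with_fst (m == 2) u) (with_fst false v) != vec0 ->
    4 <= size (odd_span (m == 2) u v))%N ->
  forall u v, u \in G -> v \in G -> [~ u, v] != 1 -> (8 <= #|phi2 u v|)%N.
Proof.
move=> ge8 ge4.
have mixed u v : u \in G -> v \in G -> [~ u, v] != 1 ->
    u ^+ 2 \notin G^`(1) -> v ^+ 2 \in G^`(1) -> (8 <= #|phi2 u v|)%N.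
  move=> Gu Gv uv u2 v2; rewrite leqNgt; apply/negP.
  by case/(phi2_odd Gu Gv uv u2 v2)=> u' [v' [/ge4]]; rewrite leqNgt => /negP.
move=> u v Gu Gv uv; have [u2|u2] := boolP (u ^+ 2 \in G^`(1));
  have [v2|v2] := boolP (v ^+ 2 \in G^`(1)).
- have [u' [v' [cE ->]]] := phi2_even Gu Gv u2 v2.
  by apply: ge8; rewrite -nu_neq1 -cE.
- by rewrite phi2C // mixed // commg_sym.
- exact: mixed.
rewrite leqNgt; apply/negP => lt8.
have Gvu : v * u \in G by rewrite groupM.
have sub := phi2_mulX 1 Gu Gv; rewrite expg1 in sub.
suff vu2 : (v * u) ^+ 2 \in G^`(1).
  have := leq_trans (mixed u (v * u) Gu Gvu _ u2 vu2) (subset_leq_card sub).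
  by rewrite leqNgt lt8 commgMr // commgg mulg1 uv => /(_ isT).
have nG : {subset G <= 'N(G^`(1))} := subsetP (der_norm 1 G).
(* For such g the exponent of a1 is an odd multiple of 2^(m-2), so modulo G' its square is
   a1^(2^(m-1) s) with s odd. *)
have quarter g : g \in G -> g ^+ 2 \in phi2 u v -> g ^+ 2 \notin G^`(1) ->
    exists2 s, odd s & f g ^+ 2 = f a1 ^+ (2 ^ m.-1 * s).
  move=> Gg Ag; have [i [j [k [h dh [_ _ fg2]]]]] := word_der_sqr Gg.
  have := expg2_phi2_der Gu Gv uv lt8 Ag; case/setIP=> _.
  have Gg2 : g ^+ 2 \in G by rewrite groupX.
  rewrite !mem_der_sqr // {1}/f morphX ?nG //= -/f fg2 -expgM => /eqP.
  rewrite mulnAC => /sqr_quarter[s iE] nt; exists s.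
    apply: contraR nt => evs; rewrite -order_dvdn o1 iE.
    exact: dvdn_quarter.
  by rewrite iE mulnA -expnS -(subSn m_gt1) subSS subn1.
have [s os fu2] := quarter u Gu (phi2_sqrl u v) u2.
have [t ot fv2] := quarter v Gv (phi2_sqrr u v) v2.
(* Modulo G' the square of v u is a1^(2^(m-1) (s + t)), trivial because s + t is even. *)
rewrite mem_der_sqr // -[u]expg1 coset_sqr_mulX // expg1 fu2 fv2 -expgD -mulnDr.
rewrite -order_dvdn o1 -{1}(prednK (ltnW m_gt1)) expnSr dvdn_pmul2l ?expn_gt0 // dvdn2.
by rewrite oddD os ot.
Qed.

(** * Pairs with extreme orders of [phi2 u v], and the upper bound *)

Lemma even_span_phi2 u v n : vec_cross (with_fst false u) (with_fst false v) != vec0 ->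
  (size (even_span u v) <= n)%N ->
  exists u' v', [/\ u' \in G, v' \in G, [~ u', v'] != 1 & (#|phi2 u' v'| <= n)%N].
Proof.
move=> c0 le; exists (even_word u), (even_word v); rewrite !even_word_in card_phi2_even_word.
split=> //; case: u c0 {le} => [[s j] k] c0; have [_ ->] := commg_even_word 0 j k s v.
by rewrite nu_neq1.
Qed.

(** Let a1 have exponent 2^(m-2) in u'. Then u'^4 = a1^(2^m) lies in a span of order at most 2, so
    u'^2 contributes at most one more factor 2. *)
Lemma odd_span_phi2 u v : vec_cross (with_fst (m == 2) u) (with_fst false v) != vec0 ->
  (size (odd_span (m == 2) u v) <= 2)%N ->
  exists u' v', [/\ u' \in G, v' \in G, [~ u', v'] != 1 & (#|phi2 u' v'| <= 4)%N].
Proof.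
case: u => [[s j] k] c0 le2; have := odd_quarter (isT : odd 1); set i := (_ * _)%N => oi.
exists (word i j k), (even_word v); rewrite word_in even_word_in.
have [cE _] := commg_even_word i j k s v; rewrite cE oi.
split=> //; first by rewrite nu_neq1.
pose B := <<[set nu r1; nu (sqr_vec v); nu (vec_cross (m == 2, j, k) (with_fst false v))]>>%G.
have [B1 B2 B3] : [/\ nu r1 \in B, nu (sqr_vec v) \in B &
    nu (vec_cross (m == 2, j, k) (with_fst false v)) \in B].
  by split; rewrite mem_gen // !inE eqxx ?orbT.
have u4 : (word i j k ^+ 2) ^+ 2 = nu r1.
  rewrite sqr_word_odd // /i.
  have -> : (2 * (2 ^ (m - 2) * 1) * 2 = 2 ^ m * 1)%N.
    by rewrite mulnC !mulnA -(expnD 2 2) subnKC.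
  by rewrite pow1X /=; case: (r1) => [[]].
have sub : phi2 (word i j k) (even_word v) \subset <[word i j k ^+ 2]> <*> B.
  apply: phi2_sub; rewrite ?cE ?sqr_even_word ?oi.
  - by apply: (subsetP (joing_subl _ _)); apply: cycle_id.
  - exact: (subsetP (joing_subr _ _)).
  - exact: (subsetP (joing_subr _ _)).
have nB : word i j k ^+ 2 \in 'N(B).
  apply: (subsetP _ _ (groupX 2 (word_in i j k))); rewrite cents_norm // centsC.
  rewrite (subset_trans _ (subset_trans PhiZ (subsetIr _ _))) //.
  by apply: gen_nu_sub; apply: nu_Phi.
apply: leq_trans (subset_leq_card sub) _.
apply: leq_trans (card_cycle_mulG_le (n := 2) nB _ _) _; rewrite ?u4 //.
by rewrite card_gen_nu (leq_mul (n1 := 2) (n2 := 2)).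
Qed.

(** Let a1 have exponent 1 in u'. Then a1^(2^m) is a power of u'^2, so the full span puts G' inside
    [phi2 u' v']; modulo G' the element u'^2 has order 2^(m-1), and 8 * 2^(m-1) = 2^(m+2). *)
Lemma full_span_phi2 u v : size (odd_span true u v) = 8 ->
  exists u' v', [/\ u' \in G, v' \in G, [~ u', v'] != 1 & (2 ^ (m + 2) <= #|phi2 u' v'|)%N].
Proof.
case: u => [[s j] k]; rewrite /odd_span -card_gen_nu => card8.
exists (word 1 j k), (even_word v); rewrite word_in even_word_in.
set A := phi2 _ _; pose c := vec_cross (with_fst true (s, j, k)) (with_fst false v).
pose B := <<[set nu r1; nu (sqr_vec v); nu c]>>%G; rewrite -/c in card8.
have [cE _] := commg_even_word 1 j k s v.
have m1 : (2 * 2 ^ m.-1 = 2 ^ m)%N by rewrite -expnS prednK // ltnW.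
have r1A : nu r1 \in A.
  have -> : nu r1 = (word 1 j k ^+ 2) ^+ (2 ^ m.-1).
    rewrite sqr_word_odd; last by rewrite oddX /=; case: m m_gt1 => [|[]].
    by rewrite muln1 m1 pow1.
  by rewrite groupX ?phi2_sqrl.
have sGA : G^`(1) \subset A.
  have <- : B = G^`(1) :> {set gT}.
    apply/eqP; rewrite eqEcard derG_card card8 andbT.
    by apply: (gen_nu_sub (B := G^`(1)%G)); apply: nu_der.
  apply: gen_nu_sub => //; first by rewrite -sqr_even_word phi2_sqrr.
  by rewrite -[nu _]cE phi2_commg.
split=> //.
  (* With a trivial commutator only two vectors would be left to span 8 elements. *)
  apply/negP => /eqP c1; have : (#|B| <= 4)%N.
    rewrite card_gen_nu; have -> : c = vec0 by apply: nu_inj; rewrite nu0 -c1 cE.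
    by case: (r1) (sqr_vec v) => [[[] []] []] [[[] []] []].
  by rewrite card8.
rewrite -(Lagrange sGA) derG_card addnC expnD -[(2 ^ 2)%N]/4.
have nG : {subset G <= 'N(G^`(1))} := subsetP (der_norm 1 G).
have sAG : A \subset G.
  by rewrite (subset_trans (phi2_sub_Phi G2 (word_in 1 j k) (even_word_in v))) ?Phi_sub.
rewrite -card_quotient ?(subset_trans sAG) ?der_norm //.
rewrite -{1}(prednK (ltnW m_gt1)) expnS mulnA leq_mul2l /=.
apply: leq_trans (dvdn_leq (cardG_gt0 _) (order_dvdG (mem_quotient G^`(1) (phi2_sqrl _ _)))).
rewrite morphX ?nG ?word_in //= -/f coset_sqr_word orderXdiv o1 -(prednK (ltnW m_gt1)) expnS.
  by rewrite muln1 mulKn.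
by rewrite muln1 dvdn_mulr.
Qed.

(** If a1 has odd exponent in u, say, a power of u moves v until v^2 lies in G'; then u^2 multiplies
    a span of order at most 4 by at most 2^(m-1). If both exponents are even, everything lies in
    <a1^4> G', of order at most 2^(m-2) * 8. Both bounds are 2^(m+1). *)
Lemma card_phi2_le :
  (forall u v, size (odd_span true u v) <= 4)%N ->
  forall u v, u \in G -> v \in G -> [~ u, v] != 1 -> (#|phi2 u v| <= 2 ^ (m + 1))%N.
Proof.
move=> le4.
have nG : {subset G <= 'N(G^`(1))} := subsetP (der_norm 1 G).
have nF : G \subset 'N(G^`(1)) := der_norm 1 G.
have one_odd u v i j k h : u \in G -> v \in G -> u = word i j k * h -> h \in G^`(1) ->
    f u ^+ 2 = f a1 ^+ (2 * i) -> odd i -> (#|phi2 u v| <= 2 ^ (m + 1))%N.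
  move=> Gu Gv uE dh fu2 oi.
  have [n n2] : exists n, (v * u ^+ n) ^+ 2 \in G^`(1).
    have [i' [j' [k' [h' dh' [_ _ fv2]]]]] := word_der_sqr Gv.
    have : coprime i (2 ^ m) by rewrite coprimeXr // coprimen2.
    case/(coprimeP _ (odd_gt0 oi)) => -[al be] /= e1.
    (* al inverts i mod 2^m, so this n solves i' + i n = 0 mod 2^m. *)
    exists (al * (i' * (2 ^ m).-1))%N.
    rewrite mem_der_sqr ?groupM ?groupX // coset_sqr_mulX // fv2 fu2 -expgM -expgD.
    rewrite -order_dvdn o1 -mulnA -mulnDr dvdn_mull // mulnA (mulnC i).
    have -> : (al * i = 1 + be * 2 ^ m)%N.
      have lt : (be * 2 ^ m < al * i)%N by rewrite -subn_gt0 e1.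
      by rewrite -(subnK (ltnW lt)) e1.
    rewrite mulnDl mul1n addnA -[X in (X + _)%N]mulnS prednK ?expn_gt0 //.
    by apply: dvdn_add; [apply: dvdn_mull | rewrite mulnAC dvdn_mull].
  pose v' := v * u ^+ n; have Gv' : v' \in G by rewrite groupM ?groupX.
  (* The power of u with exponent [n * #[u].-1] is u^(-n), which recovers v from v'. *)
  have sub : phi2 u v \subset phi2 u v'.
    have := phi2_mulX (n * #[u].-1) Gu Gv'; rewrite /v' -mulgA -expgD.
    by rewrite -mulnS prednK ?order_gt0 // mulnC expgM expg_order expg1n mulg1.
  apply: leq_trans (subset_leq_card sub) _.
  have [s' [j' [k' [h' dh' [v'E v'2]]]]] := sqr_der_word Gv' n2.
  pose B := <<[set nu r1; nu (sqr_vec (odd s', j', k'));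
                 nu (vec_cross (true, j, k) (false, j', k'))]>>%G.
  have [B1 B2 B3] : [/\ nu r1 \in B, nu (sqr_vec (odd s', j', k')) \in B &
      nu (vec_cross (true, j, k) (false, j', k')) \in B].
    by split; rewrite mem_gen // !inE eqxx ?orbT.
  have cE : [~ u, v'] = nu (vec_cross (true, j, k) (false, j', k')).
    by rewrite uE v'E commg_mul_der ?word_in // commg_word odd_half oi.
  (* The exponent [2 ^ m.-1] is even, so the factor in G' disappears, and since i is odd what
     remains is a1^(2^m). *)
  have uX : (u ^+ 2) ^+ (2 ^ m.-1) = nu r1.
    rewrite uE sqr_mul_der ?word_in // sqr_word_odd; last first.
      by rewrite oddX /=; case: m m_gt1 => [|[]].
    rewrite mulnAC -expnS prednK ?(ltnW m_gt1) // pow1X oi.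
    by case: (r1) => [[]].
  have subA : phi2 u v' \subset <[u ^+ 2]> <*> B.
    apply: phi2_sub; rewrite ?cE ?v'2.
    - by apply: (subsetP (joing_subl _ _)); apply: cycle_id.
    - exact: (subsetP (joing_subr _ _)).
    - exact: (subsetP (joing_subr _ _)).
  have nB : u ^+ 2 \in 'N(B).
    apply: (subsetP _ _ (groupX 2 Gu)); rewrite cents_norm // centsC.
    rewrite (subset_trans _ (subset_trans PhiZ (subsetIr _ _))) //.
    by apply: gen_nu_sub; apply: nu_Phi.
  apply: leq_trans (subset_leq_card subA) _.
  apply: leq_trans (card_cycle_mulG_le (n := 2 ^ m.-1) nB _ _) _; rewrite ?uX ?expn_gt0 //.
  rewrite card_gen_nu addn1 expnS -{2}(prednK (ltnW m_gt1)) expnS mulnA mulnC leq_mul2r.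
  by rewrite (le4 (true, j, k) (odd s', j', k')) orbT.
move=> u v Gu Gv uv.
have [i [j [k [h dh [uE u2 fu2]]]]] := word_der_sqr Gu.
have [i' [j' [k' [h' dh' [vE v2 fv2]]]]] := word_der_sqr Gv.
have [oi|ei] := boolP (odd i); first exact: one_odd Gu Gv uE dh fu2 oi.
have [oi'|ei'] := boolP (odd i'); first by rewrite phi2C // (one_odd _ _ _ _ _ _ Gv Gu vE dh' fv2).
have nB : a1 ^+ 4 \in 'N(G^`(1)) by rewrite nG ?groupX.
have in4 x y t : ~~ odd x -> y = a1 ^+ (2 * x) * nu t -> y \in <[a1 ^+ 4]> <*> G^`(1).
  move=> ex ->; apply: groupM; last by apply: (subsetP (joing_subr _ _)); apply: nu_der.
  apply: (subsetP (joing_subl _ _)); rewrite -(odd_double_half x) (negPf ex) add0n -mul2n.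
  by rewrite mulnA expgM mem_cycle.
have sub : phi2 u v \subset <[a1 ^+ 4]> <*> G^`(1).
  apply: phi2_sub; rewrite ?u2 ?v2 ?sqr_word.
  - exact: in4 ei _.
  - exact: in4 ei' _.
  - by apply: (subsetP (joing_subr _ _)); apply: mem_commg.
apply: leq_trans (subset_leq_card sub) _.
apply: leq_trans (card_cycle_mulG_le (n := 2 ^ (m - 2)) nB _ _) _; rewrite ?expn_gt0 //.
  by rewrite -expgM -(expnD 2 2) subnKC // pow1 nu_der.
by rewrite derG_card -(expnD 2 _ 3) leq_exp2l // -{2}(subnK m_gt1) -addnA.
Qed.

(** * Indices of A_1-subgroups and computable criteria for I_min and I_max *)

Lemma A1_subgroup_gen2 (H : {group gT}) : A1_subgroup H G ->
  exists u v, [/\ u \in G, v \in G, [~ u, v] != 1 & H = <<[set u; v]>> :> {set gT}].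
Proof.
case/andP=> sHG /andP[nabH /forallP minH].
have /exists_inP[u Hu /exists_inP[v Hv uv]] :
    [exists u in H, exists v in H, [~ u, v] != 1].
  apply: contraR nabH; rewrite negb_exists_in => /forall_inP cH; apply/centsP => u Hu v Hv.
  have := cH u Hu; rewrite negb_exists_in => /forall_inP/(_ v Hv).
  by rewrite negbK => /commgP.
have [Gu Gv] := (subsetP sHG u Hu, subsetP sHG v Hv).
exists u, v; split=> //; apply/eqP; rewrite eq_sym eqEproper gen_subG; apply/andP; split.
  by apply/subsetP=> z; rewrite !inE => /orP[]/eqP->.
(* A proper subgroup would be abelian, but u and v do not commute. *)
have := minH <<[set u; v]>>%G; apply: contraL => ->.
exact: gen2_nonabelian.
Qed.

Lemma A1_index_le k :
    (forall u v, u \in G -> v \in G -> [~ u, v] != 1 -> (2 ^ k <= #|phi2 u v|)%N) ->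
  forall H : {group gT}, A1_subgroup H G -> (#|G : H| * 2 ^ k <= 2 ^ (m + 3))%N.
Proof.
move=> ge H /A1_subgroup_gen2[u [v [Gu Gv uv ->]]].
by rewrite -(index_gen2 Gu Gv uv) leq_mul2l ge ?orbT.
Qed.

Lemma A1_index_ge k :
    (forall u v, u \in G -> v \in G -> [~ u, v] != 1 -> (#|phi2 u v| <= 2 ^ k)%N) ->
  forall H : {group gT}, A1_subgroup H G -> (2 ^ (m + 3) <= #|G : H| * 2 ^ k)%N.
Proof.
move=> le H /A1_subgroup_gen2[u [v [Gu Gv uv ->]]].
by rewrite -(index_gen2 Gu Gv uv) leq_mul2l le ?orbT.
Qed.

Lemma gen2_A1_subgroup u v : u \in G -> v \in G -> [~ u, v] != 1 ->
  A1_subgroup <<[set u; v]>>%G G.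
Proof. by move=> Gu Gv uv; rewrite /A1_subgroup gen2_sub //; apply: (gen2_A1 G2 PhiZ). Qed.

(** Through [nu] the size of a span is the order of a 2-group, hence a power of 2. *)
Lemma span3_le k a b c : (size (span3 a b c) < 2 ^ k.+1 -> size (span3 a b c) <= 2 ^ k)%N.
Proof.
rewrite -card_gen_nu; apply: (@card_pgroup_le _ 2 _ <<_>>) => //.
by apply: pgroupS G2; apply: gen_nu_sub; apply: nu_in.
Qed.

(** Spans have size 1, 2, 4 or 8, so a size above 4 means all of F_2^3. *)
Definition has_full_span :=
  has (fun u => has (fun v => 4 < size (odd_span true u v))%N all_vecs) all_vecs.

Definition has_even_span n := has (fun u => has (fun v =>
  (vec_cross (with_fst false u) (with_fst false v) != vec0) && (size (even_span u v) < n)%N)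
  all_vecs) all_vecs.

Definition has_odd_span p := has (fun u => has (fun v =>
  (vec_cross (with_fst p u) (with_fst false v) != vec0) && (size (odd_span p u v) < 4)%N)
  all_vecs) all_vecs.

(** The difference of I_max and m: index times order of [phi2 u v] is 2^(m+3), so the least orders
    2, 4, 8 give 2, 1, 0. The boolean in the second branch is read as a number. *)
Definition Imax_excess p : nat :=
  if has_even_span 4 then 2 else has_even_span 8 || has_odd_span p.

Lemma has_full_spanP :
  reflect (exists u v, 4 < size (odd_span true u v))%N has_full_span.
Proof. exact: has_vecsP. Qed.

Lemma has_even_spanP n : reflect (exists u v,
    (vec_cross (with_fst false u) (with_fst false v) != vec0) && (size (even_span u v) < n)%N)
  (has_even_span n).
Proof. exact: has_vecsP. Qed.

Lemma has_odd_spanP p : reflect (exists u v,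
    (vec_cross (with_fst p u) (with_fst false v) != vec0) && (size (odd_span p u v) < 4)%N)
  (has_odd_span p).
Proof. exact: has_vecsP. Qed.
(** Without a full span every [phi2 u v] has order at most 2^(m+1), which forces index at least
    4. *)
Lemma has_Imin1 : has_Imin G 1 -> has_full_span.
Proof.
case=> -[H A1H iH] _; apply/negPn/negP => /has_full_spanP nfull.
have le4 u v : (size (odd_span true u v) <= 4)%N.
  by rewrite leqNgt; apply/negP => lt; apply: nfull; exists u, v.
have := A1_index_ge (card_phi2_le le4) A1H.
by rewrite iH -expnD leq_exp2l // addnCA leq_add2l.
Qed.

(** A full span yields an A_1-subgroup of index at most 2. *)
Lemma has_Imin2 : has_Imin G 2 -> ~~ has_full_span.
Proof.
case=> _ minG; apply/negP => /has_full_spanP[u [v gt4]].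
have e8 : size (odd_span true u v) = 8.
  apply/eqP; rewrite eqn_leq (leq_trans (size_undup _)) //= leqNgt.
  by apply: contraL gt4 => lt8; rewrite -leqNgt; apply: (span3_le (k := 2)).
have [u' [v' [Gu Gv uv ge]]] := full_span_phi2 e8.
have /= le := minG _ (gen2_A1_subgroup Gu Gv uv).
have := leq_mul le ge; rewrite (index_gen2 Gu Gv uv) -expnD leq_exp2l // addnCA leq_add2l.
by [].
Qed.

Lemma has_Imax_le k n : has_Imax G k ->
    (forall u v, u \in G -> v \in G -> [~ u, v] != 1 -> (2 ^ n <= #|phi2 u v|)%N) ->
  (k + n <= m + 3)%N.
Proof.
by case=> -[H A1H iH] _ /A1_index_le /(_ H A1H); rewrite iH -expnD leq_exp2l.
Qed.

Lemma has_Imax_ge k n : has_Imax G k ->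
    (exists u v, [/\ u \in G, v \in G, [~ u, v] != 1 & (#|phi2 u v| <= 2 ^ n)%N]) ->
  (m + 3 <= k + n)%N.
Proof.
move=> [_ maxG] [u [v [Gu Gv uv le]]]; have := leq_mul (maxG _ (gen2_A1_subgroup Gu Gv uv)) le.
by rewrite (index_gen2 Gu Gv uv) -expnD leq_exp2l.
Qed.

Lemma has_ImaxE k : has_Imax G k -> k = (m + Imax_excess (m == 2))%N.
Proof.
move=> kG; apply/eqP; rewrite eqn_leq /Imax_excess; apply/andP.
have [/has_even_spanP[u [v /andP[c0 /(span3_le (k := 1)) le2]]]|/has_even_spanP n4] := ifPn.
  have gt := has_Imax_ge (n := 1) kG (even_span_phi2 c0 le2).
  have /(has_Imax_le (n := 1) kG) le u' v' : u' \in G -> v' \in G ->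
      [~ u', v'] != 1 -> (2 ^ 1 <= #|phi2 u' v'|)%N.
    move=> Gu Gv uv; apply: leq_trans (phi2_der_card_gt1 Gu Gv uv) _.
    by rewrite subset_leq_card ?subsetIl.
  by move: gt le; rewrite -[3]/(2 + 1)%N addnA !leq_add2r.
have ge4 u v : vec_cross (with_fst false u) (with_fst false v) != vec0 ->
    (4 <= size (even_span u v))%N.
  by move=> c0; rewrite leqNgt; apply/negP => lt4; apply: n4; exists u, v; rewrite c0.
have /= := has_Imax_le (n := 2) kG (phi2_ge4 ge4).
rewrite -[3]/(1 + 2)%N addnA leq_add2r => le1.
have [/has_even_spanP[u [v /andP[c0 /(span3_le (k := 2)) le4]]]|/has_even_spanP n8] :=
  boolP (has_even_span 8).
  have := has_Imax_ge (n := 2) kG (even_span_phi2 c0 le4).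
  by rewrite -[3]/(1 + 2)%N addnA leq_add2r.
have [/has_odd_spanP[u [v /andP[c0 /(span3_le (k := 1)) le2]]]|/has_odd_spanP no] :=
  boolP (has_odd_span _).
  have := has_Imax_ge (n := 2) kG (odd_span_phi2 c0 le2).
  by rewrite -[3]/(1 + 2)%N addnA leq_add2r.
rewrite addn0; split.
  have := has_Imax_le (n := 3) kG (phi2_ge8 _ _); rewrite leq_add2r; apply=> u v c0.
    by rewrite leqNgt; apply/negP => lt8; apply: n8; exists u, v; rewrite c0.
  by rewrite leqNgt; apply/negP => lt8; apply: no; exists u, v; rewrite c0.
(* The two vectors stand for a2 and a3, whose commutator x is nontrivial; no span exceeds 8
   elements. *)
have := has_Imax_ge (n := 3) kG (even_span_phi2 (u := (false, true, false))
  (v := (false, false, true)) (n := 8) isT (size_undup _)).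
by rewrite leq_add2r.
Qed.

End Coordinates.

(** * Rows of the listed matrices and the final enumeration *)

Definition row_vec (w : 'M['F_2]_3) (i : nat) : vec :=
  (w (ix i) (ix 1) != 0, w (ix i) (ix 2) != 0, w (ix i) (ix 3) != 0)%R.

Lemma row_wordE (gT : finGroupType) (w : 'M['F_2]_3) (a1 a2 a3 : gT) i :
  row_word w [~ a2, a3] [~ a3, a1] [~ a1, a2] i = nu a1 a2 a3 (row_vec w i).
Proof.
have F2 (t : 'F_2) : t = (t != 0)%R :> nat by case: t => [[|[|[]]] lt2].
by rewrite /row_word /nu /= -!F2.
Qed.

Lemma row_vecD (A B : 'M['F_2]_3) i : row_vec (A + B)%R i = vec_add (row_vec A i) (row_vec B i).
Proof.
have F2 (s t : 'F_2) : (s + t != 0)%R = (s != 0)%R (+) (t != 0)%R.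
  by case: s => [[|[|?]] ?] //; case: t => [[|[|?]] ?].
by rewrite /row_vec /= !mxE !F2.
Qed.

Lemma row_vec_e i j k : (0 < i <= 3)%N -> (0 < j <= 3)%N -> (0 < k <= 3)%N ->
  row_vec (e i j) k = vec_scale (i == k) (j == 1%N, j == 2, j == 3).
Proof.
have eq_ix a b : (0 < a <= 3)%N -> (0 < b <= 3)%N -> (ix a == ix b) = (a == b).
  by case: a b => [|a] [|b] //= ? ?; rewrite -val_eqE /= !inordK // eqSS.
move=> i3 j3 k3; rewrite /row_vec /e !mxE !eq_ix // ![_ == i]eq_sym ![_ == j]eq_sym.
by case: (i == k); case: (j == 1%N); case: (j == 2); case: (j == 3).
Qed.

(** Explicit boolean triples in place of rows keep matrices over F_2 out of the later evaluation. *)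
Ltac compute_rows :=
  repeat match goal with |- context [row_vec ?M ?i] =>
    let H := fresh in
    eassert (row_vec M i = _) as H by
      (unfold M; rewrite ?row_vecD ?row_vec_e //=; reflexivity);
    rewrite H; clear H
  end.

Ltac find_member :=
  lazymatch goal with
  | |- is_true (?x \in ?x :: _) => exact: mem_head
  | |- is_true (_ \in _ :: _) => rewrite in_cons; apply/orP; right; find_member
  end.

(** Either the premise evaluates to a contradiction or the matrix occurs in the list; the last
    alternative settles (N1) and (N2), where the claim includes a condition on m1. *)
Ltac decide_class :=
  first
  [ let H := fresh in intro H; exfalso; vm_compute in H; discriminate H
  | intros _; find_member
  | intros _; left; find_member
  | intros _; right; split; [find_member | first [done | match goal with
      H : is_true false \/ _ |- _ => by case: H end]]].

Unset Implicit Arguments.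

Theorem theorem7p4 (gT : finGroupType) (G : {group gT}) (m1 : nat)
    (w : 'M['F_2]_3)
    (G2 : 2.-group G)
    (dG : 'm(G) = 3%N)
    (PhiZ : 'Phi(G) \subset 'Z(G))
    (derG_abelem : 2.-abelem G^`(1))
    (derG_card : #|G^`(1)| = 8)
    (m1_gt1 : (1 < m1)%N)
    (typeG : abelian_type (G / G^`(1)) = [:: (2 ^ m1)%N; 2; 2])
    (w_listed : w \in listed_matrices)
    (wG : characteristic_matrix G m1 1 1 w) :
  [/\ has_Imin G 1 ->
        w \in [:: M2; M3; M4; M5; M6; M7; N5; N6; N10; N12; N13],
      has_Imin G 2 ->
        w \in [:: M1; N1; N2; N3; N4; N7; N8; N9; N11; O1; O2; O3],
      has_Imax G (m1 + 2) ->
        w \in [:: N11; N12; N13; O1; O2; O3],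
      has_Imax G (m1 + 1) ->
        w \in [:: M4; M5; M6; M7; N4; N5; N6; N7; N8; N9; N10]
        \/ (w \in [:: N1; N2] /\ m1 = 2)
    & has_Imax G m1 ->
        w \in [:: N3; M1; M2; M3] \/ (w \in [:: N1; N2] /\ (2 < m1)%N)].
Proof.
case: wG => a1 [a2 [a3 /= [[Ga1 Ga2 Ga3] dec [o1 o2 o3] [pow1 pow2 pow3]]]].
rewrite !row_wordE in pow1 pow2 pow3.
have := has_ImaxE G2 PhiZ derG_abelem derG_card m1_gt1 Ga1 Ga2 Ga3 dec o1 o2 o3 pow1 pow2 pow3.
have := has_Imin2 G2 PhiZ derG_card m1_gt1 Ga1 Ga2 Ga3 dec o1 o2 o3 pow1 pow2 pow3.
have := has_Imin1 G2 PhiZ derG_abelem derG_card m1_gt1 Ga1 Ga2 Ga3 dec o1 o2 o3 pow1 pow2 pow3.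
set full := has_full_span _ _ _; set exc := Imax_excess _ _ _ _ => Imin1 Imin2 ImaxE.
have Imax k : has_Imax G (m1 + k) -> k = exc by move/ImaxE/addnI.
have Imax0 : has_Imax G m1 -> 0%N = exc by move=> mG; apply: Imax; rewrite addn0.
have m1_or : (m1 == 2) = ~~ (2 < m1)%N by rewrite -leqNgt eqn_leq m1_gt1 andbT.
suff cls : [/\ full -> w \in [:: M2; M3; M4; M5; M6; M7; N5; N6; N10; N12; N13],
      ~~ full -> w \in [:: M1; N1; N2; N3; N4; N7; N8; N9; N11; O1; O2; O3],
      2 = exc -> w \in [:: N11; N12; N13; O1; O2; O3],
      1%N = exc -> w \in [:: M4; M5; M6; M7; N4; N5; N6; N7; N8; N9; N10]
        \/ (w \in [:: N1; N2] /\ m1 = 2)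
    & 0%N = exc -> w \in [:: N3; M1; M2; M3] \/ (w \in [:: N1; N2] /\ (2 < m1)%N)].
  case: cls => c1 c2 c3 c4 c5; split.
  - by move/Imin1.
  - by move/Imin2.
  - by move/Imax.
  - by move/Imax.
  - by move/Imax0.
clear -w_listed m1_or; rewrite {}/full {}/exc m1_or.
have eqm : ~~ (2 < m1)%N -> m1 = 2 by rewrite -m1_or => /eqP.
(* With [2 < m1] abstracted to a boolean, each criterion becomes a closed term once the matrix is
   fixed and the boolean is split; [eqm] keeps the equation m1 = 2 for the false case. *)
move: (2 < m1)%N eqm => gt2 eqm {m1_or}.
have {}eqm : gt2 \/ m1 = 2 by case: gt2 eqm => [|eq2]; [left | right; apply: eq2].
move: w_listed; rewrite /listed_matrices.
do 23! (case/predU1P=> [->|]; first by compute_rows; case: gt2 eqm => eqm; split; decide_class).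
by [].
Qed.
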